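(* Let $P$ be a partition of $R_c$ and $C$ a straightening set of $P$ such that $P$ is $C$-confluent, and let $Q$ be a partition of $L_c$ and $C'$ a straightening set of $Q$ such that $Q$ is $C'$-confluent. Let $D=C\cup C'$ and let $U$ be a disjoint union of $P$ and $Q$. Then $U$ is $D$-confluent.
   Context: Fix positive integers $c\le n$. $S_m$ is the set of permutations of $\{1,\dots,m\}$ written as words. A word $w_1\cdots w_c$ (distinct integer letters) forms $u\in S_c$ if there is an integer $k$ with $w_i=u_i+k$ for all $i$. A hit in $w\in S_n$ is a contiguous subword of length $c$ forming some $u\in S_c$. For a partition $P$ of a subset of $S_c$, a $P$-hit is a hit forming a permutation in some part of $P$; a $P$-rearrangement rearranges the letters of a $P$-hit in place so that the new subword forms a permutation in the same part of $P$. Tail size of a word $w$ of length $m$ with distinct letters: least $k\ge1$ such that the first $k$ letters are the $k$ smallest letters of $w$. $w$ is right leaning if its tail size is $<m$, left leaning if its reversal has tail size $<m$, omni leaning if neither. $R_c,L_c,O_c$: the right, left, omni leaning permutations in $S_c$. Polarization of a hit $h$ in $w\in S_n$: if $h$ is all of $w$, $h$ is left polarized. Otherwise let $a$ be the average of the letters of $h$, $w'$ be $w$ with $h$ replaced by the single letter $a$, and $b$ the letter adjacent to $a$ in $w'$ closest in value to $a$ (ties: the left one). If $a,b$ appear in increasing order in $w'$, $h$ is right polarized; if decreasing, left polarized. A hit is backward if it is right polarized and left leaning, or left polarized and right leaning, or omni leaning; otherwise forward. A straightening set $C$ of $P$ is a set of permutations from the parts of $P$ containing exactly: one left leaning permutation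 from each part containing a left leaning permutation, one right leaning permutation from each part containing a right leaning permutation, and one permutation from each part containing only omni leaning permutations. A $P$-hit $h$ is $(P,C)$-straightened if it forms a permutation in $C$ and either it is forward, or it is backward and no $P$-rearrangement of $h$ makes it forward. $(P,C)$-straightening a $P$-hit means applying a $P$-rearrangement so it becomes $(P,C)$-straightened. The $(P,C)$-straightening operator $\to$ on $S_n$: $w\to w'$ iff $w'$ is obtained from $w$ by $(P,C)$-straightening a not-yet-$(P,C)$-straightened $P$-hit of $w$. A relation $\to$ on a finite set $A$ with reflexive-transitive closure $\to'$ is confluent if there are no distinct $a,b$ with $a\to'b$ and $b\to'a$, and each connected component $K$ of $(A,\to)$ has a unique node $m$ with $x\to'm$ for all $x\in K$. $P$ is $C$-confluent if the $(P,C)$-straightening operator on $S_n$ is confluent. Disjoint union: if $J,K,U$ are partitions of $A,B,E\subseteq S_c$ with $A\cap B=\emptyset$ and $A\cup B=E$, then $U$ is a disjoint union of $J$ and $K$ if each part of $U$ is the disjoint union of a (possibly empty) part of $J$ and a (possibly empty) part of $K$. *)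

(* Defs.v *)
From Stdlib Require Export Relations.
From mathcomp Require Export all_boot all_order all_fingroup all_algebra.

Set Implicit Arguments.
Unset Strict Implicit.
Unset Printing Implicit Defensive.

Import Order.TTheory GRing.Theory Num.Theory.
Local Open Scope ring_scope.

(* Words are sequences of integers.  A permutation of 'I_m is read as the     *)
(* word w_1 ... w_m on the letters 1, ..., m, hence the shift by one below.   *)
Definition word m (w : 'S_m) : seq int := [seq (w i).+1%:Z | i <- enum 'I_m].

Definition forms c (s : seq int) (u : 'S_c) : Prop :=
  exists k : int, s = [seq x + k | x <- word u].

Definition smallest_first (s : seq int) (k : nat) : bool :=
  perm_eq (take k s) (take k (sort <=%R s)).

(* The least k >= 1 such that smallest_first s k; for nonempty s it exists    *)
(* and is at most size s.                                                     *)
Definition tail_size (s : seq int) : nat :=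
  (find (smallest_first s) (iota 1 (size s))).+1.

Definition right_leaning (s : seq int) : bool := (tail_size s < size s)%N.
Definition left_leaning (s : seq int) : bool := (tail_size (rev s) < size s)%N.
Definition omni_leaning (s : seq int) : bool :=
  ~~ right_leaning s && ~~ left_leaning s.

Definition Rset c : {set 'S_c} := [set u | right_leaning (word u)].
Definition Lset c : {set 'S_c} := [set u | left_leaning (word u)].
Definition Oset c : {set 'S_c} := [set u | omni_leaning (word u)].

(* A hit is identified with the 0-based position i of its first letter.       *)
Definition subword c (s : seq int) (i : nat) : seq int := take c (drop i s).

Definition average (s : seq int) : rat :=
  (\sum_(x <- s) x%:Q) / (size s)%:R.

Definition contract c (s : seq int) (i : nat) : seq rat :=
  [seq x%:Q | x <- take i s] ++ average (subword c s i)
    :: [seq x%:Q | x <- drop (i + c) s].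

(* The position of the letter adjacent to position i of t whose value is      *)
(* closest to that of the letter at position i, the left one in case of a     *)
(* tie.  Meaningful for i < size t and 1 < size t.                            *)
Definition neighbor (t : seq rat) (i : nat) : nat :=
  if (0 < i)%N && ((i.+1 == size t) ||
       (`|nth 0 t i.-1 - nth 0 t i| <= `|nth 0 t i.+1 - nth 0 t i|))
  then i.-1 else i.+1.

Definition right_polarized c (s : seq int) (i : nat) : bool :=
  let t := contract c s i in let j := neighbor t i in
  (size s != c) && (nth 0 t (minn i j) < nth 0 t (maxn i j)).

Definition left_polarized c (s : seq int) (i : nat) : bool :=
  let t := contract c s i in let j := neighbor t i in
  (size s == c) || (nth 0 t (maxn i j) < nth 0 t (minn i j)).

Definition backward c (s : seq int) (i : nat) : bool :=
  [|| right_polarized c s i && left_leaning (subword c s i),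
      left_polarized c s i && right_leaning (subword c s i)
    | omni_leaning (subword c s i)].

Definition forward c (s : seq int) (i : nat) : bool := ~~ backward c s i.

Section Operator.

Variables (n c : nat) (P : {set {set 'S_c}}) (C : {set 'S_c}).
Implicit Types (w : 'S_n) (i : nat).

(* forms forces the subword at i to have full length c.                       *)
Definition P_hit w i : Prop :=
  exists2 u : 'S_c, u \in cover P & forms (subword c (word w) i) u.

Definition P_rearrangement w i w' : Prop :=
  [/\ take i (word w') = take i (word w),
      drop (i + c) (word w') = drop (i + c) (word w),
      perm_eq (subword c (word w') i) (subword c (word w) i) &
      exists X u v, [/\ X \in P, u \in X, v \in X,
        forms (subword c (word w) i) u & forms (subword c (word w') i) v]].

Definition straightened w i : Prop :=
  (exists2 u : 'S_c, u \in C & forms (subword c (word w) i) u) /\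
  (forward c (word w) i \/
   backward c (word w) i /\
     forall w', P_rearrangement w i w' -> ~ forward c (word w') i).

Definition straightening w w' : Prop :=
  exists i, [/\ P_hit w i, ~ straightened w i,
    P_rearrangement w i w' & straightened w' i].

End Operator.

(* Connected components are those of the underlying undirected graph.         *)
Definition component (A : Type) (r : relation A) (x : A) : A -> Prop :=
  clos_refl_sym_trans A r x.

Definition confluent (A : finType) (r : relation A) : Prop :=
  (forall a b : A, clos_refl_trans A r a b -> clos_refl_trans A r b a ->
     a = b) /\
  (forall z : A, exists! m : A, component r z m /\
     forall x, component r z x -> clos_refl_trans A r x m).

Definition straightening_set c (P : {set {set 'S_c}}) (C : {set 'S_c}) : Prop :=
  C \subset cover P /\
  forall X, X \in P ->
    [/\ X :&: Lset c != set0 -> #|C :&: X :&: Lset c| = 1%N,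
        X :&: Rset c != set0 -> #|C :&: X :&: Rset c| = 1%N,
        X \subset Oset c -> #|C :&: X| = 1%N &
        ~~ (X \subset Oset c) -> C :&: X :&: Oset c = set0].

Definition C_confluent n c (P : {set {set 'S_c}}) (C : {set 'S_c}) : Prop :=
  confluent (@straightening n c P C).

(* Parts of a partition are nonempty, so "a possibly empty part of J" is      *)
(* either set0 or an element of J.                                            *)
Definition disjoint_union c (A B : {set 'S_c}) (J K U : {set {set 'S_c}}) : Prop :=
  [/\ [disjoint A & B], partition J A, partition K B, partition U (A :|: B) &
      forall X, X \in U -> exists Y Z,
        [/\ Y = set0 \/ Y \in J, Z = set0 \/ Z \in K,
            [disjoint Y & Z] & X = Y :|: Z]].

(* Main.v *)
(* A hit meeting another hit shares an interval of values with it, and this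
   forces both to lean to the same side and to be polarized to that side: hits
   that overlap others are forward.  The polarization of a hit never changes as
   long as it stays a hit, so straightening for U is a mixture of straightening
   for P, straightening for Q, and flips of isolated backward hits from one side
   to the other.  Flips lower the number of flippable backward hits, which the
   other steps do not raise; a step for P lowers the number of words reachable
   by steps for P and, since hits of opposite leanings are disjoint, does not
   raise the number of words reachable by steps for Q, and vice versa.  This
   gives a terminating measure.
   Two steps from a word at disjoint hits commute; two steps at overlapping hits
   are joined by the confluence of P (or Q), through steps which are either
   steps for U or are bypassed by flipping both of their ends.  These detours
   stay below the initial word for the measure, which is enough for
   confluence. *)

Require Import Defs.
From mathcomp Require Import zify ring.
Set Implicit Arguments.
Unset Strict Implicit.
Unset Printing Implicit Defensive.
Import Order.TTheory GRing.Theory Num.Theory.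
Local Open Scope ring_scope.

(** * Confluence from connectedness below a measure *)

Section Confluence.
Variable A : Type.
Implicit Types r : relation A.

Lemma clos_rt_mono r r' x y : (forall x y, r x y -> r' x y) ->
  clos_refl_trans A r x y -> clos_refl_trans A r' x y.
Proof.
move=> rr'; elim=> {x y} [x y xy|x|x y z _ xy _ yz]; first exact/rt_step/rr'.
  exact: rt_refl.
exact: rt_trans yz.
Qed.

Lemma clos_rst_mono r r' x y : (forall x y, r x y -> r' x y) ->
  clos_refl_sym_trans A r x y -> clos_refl_sym_trans A r' x y.
Proof.
move=> rr'; elim=> {x y} [x y xy|x|x y _ xy|x y z _ xy _ yz]; first exact/rst_step/rr'.
- exact: rst_refl.
- exact: rst_sym.
- exact: rst_trans yz.
Qed.

Lemma clos_rt_rst r x y : clos_refl_trans A r x y -> clos_refl_sym_trans A r x y.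
Proof.
elim=> {x y} [x y xy|x|x y z _ xy _ yz]; first exact: rst_step.
  exact: rst_refl.
exact: rst_trans yz.
Qed.

Definition joinable r x y := exists2 z, clos_refl_trans A r x z & clos_refl_trans A r y z.

Variables (r : relation A) (mu : A -> nat).
Hypothesis mu_decr : forall x y, r x y -> (mu y < mu x)%N.

(** Bounding the source of each step suffices: [r] lowers [mu], so the other end lies below [M] as
    well. *)
Definition connected_below M :=
  clos_refl_sym_trans A (fun x y => r x y /\ (mu x < M)%N).

Lemma mu_rt x y : clos_refl_trans A r x y -> x = y \/ (mu y < mu x)%N.
Proof.
elim=> {x y} [x y /mu_decr|x|x y z _ [->|xy] _ [<-|yz]]; try by [left|right|right].
by right; apply: ltn_trans xy.
Qed.

Lemma mu_rt_le x y : clos_refl_trans A r x y -> (mu y <= mu x)%N.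
Proof. by case/mu_rt=> [->//|/ltnW]. Qed.

Lemma connected_below_rt M x y : clos_refl_trans A r x y -> (mu x < M)%N ->
  connected_below M x y.
Proof.
elim=> {x y} [x y xy xM|x _|x y z xy IHx yz IHy xM]; first exact: rst_step.
  exact: rst_refl.
apply: (rst_trans _ _ _ y); first exact: IHx.
by apply: IHy; apply: leq_ltn_trans xM; apply: mu_rt_le.
Qed.

Hypothesis peak_below : forall w a b, r w a -> r w b -> connected_below (mu w) a b.

Lemma rt_inv x y : clos_refl_trans A r x y ->
  x = y \/ exists2 a, r x a & clos_refl_trans A r a y.
Proof.
move=> /(@clos_rt_rt1n _ _ _ _) xy; case: y / xy => [|a y xa ay]; first by left.
by right; exists a => //; apply: clos_rt1n_rt.
Qed.

(* Winkler-Buchberger refinement of Newman's lemma. *)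
Lemma connected_below_joinable M x y : connected_below M x y -> joinable r x y.
Proof.
elim/ltn_ind: M x y => M IH x y.
have conf w u v : (mu w < M)%N -> clos_refl_trans A r w u -> clos_refl_trans A r w v ->
    joinable r u v.
  move=> wM /rt_inv[<-|[a wa au]] wv; first by exists v => //; apply: rt_refl.
  case/rt_inv: wv => [<-|[b wb bv]].
    by exists u; [apply: rt_refl | apply: rt_trans (rt_step _ _ _ _ wa) au].
  apply: (IH _ wM); apply: (rst_trans _ _ _ a).
    by apply/rst_sym/connected_below_rt => //; apply: mu_decr.
  apply: (rst_trans _ _ _ b); first exact: peak_below.
  by apply/connected_below_rt => //; apply: mu_decr.
move=> xy.
(* To merge the joins of two consecutive pieces, [conf] needs their common vertex below [M], hence
   the bounds; a trivial zigzag yields none, hence the equality case. *)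
suff [->|[_ _ //]] : x = y \/ [/\ (mu x < M)%N, (mu y < M)%N & joinable r x y].
  by exists y; apply: rt_refl.
elim: xy => {x y} [x y [xy xM]|x|x y _ [->|[xM yM [z xz yz]]]
  |x y z _ [->|[xM yM [p xp yp]]] _ [<-|[yM' zM [q yq zq]]]].
- right; split=> //; first exact: ltn_trans (mu_decr xy) xM.
  by exists y; [apply: rt_step | apply: rt_refl].
- by left.
- by left.
- by right; split=> //; exists z.
- by left.
- by right; split=> //; exists q.
- by right; split=> //; exists p.
- right; split=> //; have [s ps qs] := conf _ _ _ yM yp yq.
  by exists s; [apply: rt_trans xp ps | apply: rt_trans zq qs].
Qed.

End Confluence.

Lemma confluent_eq (A : finType) (r r' : relation A) :
  (forall x y, r x y <-> r' x y) -> confluent r -> confluent r'.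
Proof.
move=> rr'; have h1 x y : r x y -> r' x y by case: (rr' x y).
have h2 x y : r' x y -> r x y by case: (rr' x y).
case=> acyc nf; split=> [a b ab ba|z].
  by apply: acyc; apply: clos_rt_mono h2 _.
have [m [[zm xm] m_uniq]] := nf z; exists m; split=> [|m' [zm' xm']].
  split=> [|x zx]; first exact: clos_rst_mono h1 zm.
  by apply: clos_rt_mono h1 _; apply: xm; apply: clos_rst_mono h2 zx.
apply: m_uniq; split=> [|x zx]; first exact: clos_rst_mono h2 zm'.
by apply: clos_rt_mono h2 _; apply: xm'; apply: clos_rst_mono h1 zx.
Qed.

Lemma confluent_below (A : finType) (r : rel A) (mu : A -> nat) :
  (forall x y, r x y -> (mu y < mu x)%N) ->
  (forall w a b, r w a -> r w b -> connected_below r mu (mu w) a b) ->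
  confluent r.
Proof.
move=> mu_decr peak; split=> [a b ab ba|z].
  case: (mu_rt mu_decr ab) => // lt_ba.
  by have := mu_rt_le mu_decr ba; rewrite leqNgt lt_ba.
have nf x : exists2 m, clos_refl_trans A r x m & forall y, ~~ r m y.
  have [M] := ubnP (mu x); elim: M x => // M IH x lt_xM.
  case: (pickP (r x)) => [y xy|nx]; last by exists x => [|y]; [apply: rt_refl|rewrite nx].
  have [|m ym m_nf] := IH y; first exact: leq_trans (mu_decr _ _ xy) lt_xM.
  by exists m => //; apply: rt_trans ym; apply: rt_step.
have [m zm m_nf] := nf z.
have m_rt y : clos_refl_trans A r m y -> m = y.
  by move=> /(@rt_inv _ r)[//|[a]]; rewrite (negPf (m_nf a)).
(* As [A] is finite, the maximum of [mu] puts every zigzag below a common bound. *)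
have to_m x : component r z x -> clos_refl_trans A r x m.
  move=> zx; have below : connected_below r mu (\max_y mu y).+1 m x.
    apply: (@clos_rst_mono _ r); last exact: rst_trans (rst_sym _ _ _ _ (clos_rt_rst zm)) zx.
    by move=> s t st; split=> //; rewrite ltnS; apply: leq_bigmax.
  by have [s /m_rt <-] := connected_below_joinable mu_decr peak below.
have zm' := clos_rt_rst zm.
exists m; split=> [|m' [_ /(_ m zm')]]; first by split.
exact: m_rt.
Qed.

(** * Leaning sequences *)

Section Sequences.
Implicit Types (s : seq int) (k : int) (m : nat).

Lemma sort_shift s k : sort <=%R [seq x + k | x <- s] = [seq x + k | x <- sort <=%R s].
Proof.
apply: (sorted_eq le_trans le_anti); first exact/sort_sorted/le_total.
  rewrite (mono_sorted (e := <=%R)); first exact/sort_sorted/le_total.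
  by move=> x y; rewrite lerD2r.
by rewrite perm_sort perm_map // perm_sym perm_sort.
Qed.

Lemma tail_size_shift s k : tail_size [seq x + k | x <- s] = tail_size s.
Proof.
rewrite /tail_size size_map; congr _.+1; apply: eq_find => m.
rewrite /smallest_first sort_shift -!map_take; apply/idP/idP; last exact: perm_map.
exact/perm_map_inj/addIr.
Qed.

Lemma right_leaning_shift s k : right_leaning [seq x + k | x <- s] = right_leaning s.
Proof. by rewrite /right_leaning tail_size_shift size_map. Qed.

Lemma left_leaning_shift s k : left_leaning [seq x + k | x <- s] = left_leaning s.
Proof. by rewrite /left_leaning -map_rev tail_size_shift size_map. Qed.

(** Sorting the two pieces separately sorts [s], so its first [m] letters are the [m] smallest and
    its tail size is at most [m]. *)
Lemma right_leaning_split s m : (0 < m < size s)%N ->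
  allrel <=%R (take m s) (drop m s) -> right_leaning s.
Proof.
move=> /andP[m_gt0 lt_ms] le_s.
have sm : smallest_first s m.
  rewrite /smallest_first.
  have -> : sort <=%R s = sort <=%R (take m s) ++ sort <=%R (drop m s).
    apply: (sorted_eq le_trans le_anti).
    - exact/sort_sorted/le_total.
    - rewrite sorted_pairwise; last exact: le_trans.
      rewrite pairwise_cat -!sorted_pairwise; try exact: le_trans.
      rewrite !sort_sorted ?andbT; try exact: le_total.
      by apply/allrelP=> x y; rewrite !mem_sort; apply: (allrelP le_s).
    - rewrite perm_sort -{1}(cat_take_drop m s) perm_cat // perm_sym.
      by rewrite perm_sort.
      by rewrite perm_sort.
  rewrite take_size_cat; first by rewrite perm_sym perm_sort.
  by rewrite size_sort size_take lt_ms.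
rewrite /right_leaning /tail_size.
(* The list [iota 1 (size s)] holds [m] at index [m.-1], so [find] stops there at the latest. *)
apply: leq_ltn_trans (lt_ms); rewrite -(ltn_predK m_gt0) ltnS leqNgt.
apply/negP=> /(before_find 0%N); rewrite nth_iota; last by lia.
by rewrite add1n prednK // sm.
Qed.

Lemma left_leaning_split s m : (0 < m < size s)%N ->
  allrel <=%R (drop m s) (take m s) -> left_leaning s.
Proof.
move=> lt_ms le_s; rewrite /left_leaning -(size_rev s).
apply: (@right_leaning_split _ (size s - m)%N); first by rewrite size_rev; lia.
rewrite take_rev drop_rev subKn; last by lia.
by apply/allrelP=> x y; rewrite !mem_rev; apply: (allrelP le_s).
Qed.

End Sequences.

(** * Words of permutations: leaning and sum of letters *)

Section Words.
Variable m : nat.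
Implicit Types w : 'S_m.

Lemma size_word w : size (word w) = m.
Proof. by rewrite size_map size_enum_ord. Qed.

Lemma nth_word w (p : 'I_m) : nth 0 (word w) p = (w p).+1%:Z.
Proof. by rewrite (nth_map p) ?size_enum_ord // nth_ord_enum. Qed.

Lemma right_leaning_word w a : (0 < a < m)%N ->
  (forall p q : 'I_m, (p < a <= q)%N -> (w p <= w q)%N) -> right_leaning (word w).
Proof.
move=> ha le_w; apply: (@right_leaning_split _ a); rewrite ?size_word //.
apply/allrelP=> x y /(nthP 0)[p]; rewrite size_take size_word => hp <-.
move=> /(nthP 0)[q]; rewrite size_drop size_word => hq <-.
have hp' : (p < a)%N by move: hp; case: ifP; lia.
rewrite nth_take // nth_drop.
have pm : (p < m)%N by lia.
have qm : (a + q < m)%N by lia.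
rewrite -[p]/(val (Ordinal pm)) -[(a + q)%N]/(val (Ordinal qm)) !nth_word.
by rewrite lez_nat ltnS; apply: le_w; rewrite /= hp' leq_addr.
Qed.

Lemma left_leaning_word w a : (0 < a < m)%N ->
  (forall p q : 'I_m, (p < a <= q)%N -> (w q <= w p)%N) -> left_leaning (word w).
Proof.
move=> ha le_w; apply: (@left_leaning_split _ a); rewrite ?size_word //.
apply/allrelP=> y x /(nthP 0)[q]; rewrite size_drop size_word => hq <-.
move=> /(nthP 0)[p]; rewrite size_take size_word => hp <-.
have hp' : (p < a)%N by move: hp; case: ifP; lia.
rewrite nth_take // nth_drop.
have pm : (p < m)%N by lia.
have qm : (a + q < m)%N by lia.
rewrite -[p]/(val (Ordinal pm)) -[(a + q)%N]/(val (Ordinal qm)) !nth_word.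
by rewrite lez_nat ltnS; apply: le_w; rewrite /= hp' leq_addr.
Qed.

Lemma sum_word w : (\sum_(x <- word w) x%:Q) * 2 = m%:R * (m%:R + 1).
Proof.
rewrite big_map big_enum /=.
rewrite (reindex_inj (@perm_inj _ w^-1)) /=.
under eq_bigr => i _ do rewrite permKV.
rewrite -(big_mkord xpredT (fun i => i.+1%:Z%:Q)).
elim: m => [|k IH]; first by rewrite big_geq // !mul0r.
rewrite big_nat_recr //= mulrDl IH.
by rewrite -pmulrn -natr1; ring.
Qed.

End Words.

(** Here [a] is twice the average of a hit, and [y], [y'] are letters of a hit adjacent on the
    right. If [x] and the interval lie on opposite sides of the average, either choice of neighbor
    gives the same order; on the same side, [x] is nearer than all letters of the interval or
    farther than all of them. *)
Lemma closest_stable_right (a lo hi x y y' : int) :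
  (a <= 2 * lo) || (2 * hi < a) -> lo < y <= hi -> lo < y' <= hi -> ~~ (lo < x <= hi) ->
  (if `|2 * x - a| <= `|2 * y - a| then 2 * x < a else a < 2 * y) =
  (if `|2 * x - a| <= `|2 * y' - a| then 2 * x < a else a < 2 * y').
Proof.
by move=> *; do 2 case: ifP => ?; apply/idP/idP; lia.
Qed.

Lemma closest_stable_left (a lo hi x x' y : int) :
  (a <= 2 * lo) || (2 * hi < a) -> lo < x <= hi -> lo < x' <= hi -> ~~ (lo < y <= hi) ->
  (if `|2 * x - a| <= `|2 * y - a| then 2 * x < a else a < 2 * y) =
  (if `|2 * x' - a| <= `|2 * y - a| then 2 * x' < a else a < 2 * y).
Proof.
by move=> *; do 2 case: ifP => ?; apply/idP/idP; lia.
Qed.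

(** With [true] for right, as in the polarization [pol] below, forward will mean that the two
    booleans agree. *)
Definition side c (b : bool) : {set 'S_c} := if b then Rset c else Lset c.

(** * Hits and their polarization *)

Section Hits.
Variables n c : nat.
Hypothesis c_gt0 : (0 < c)%N.
Implicit Types (w : 'S_n) (u v : 'S_c) (i k a : nat) (p q : 'I_n) (j : 'I_c).

(* With letters counted from 0, the window at i reads k + u 0, k + u 1, and so on. *)
Definition hit w i k u : bool :=
  (i + c <= n)%N &&
  [forall j : 'I_c, forall p : 'I_n, (p == i + j :> nat)%N ==> (w p == k + u j :> nat)%N].

Definition agree i w w' : bool :=
  [forall p : 'I_n, (i <= p < i + c)%N || (w p == w' p)].

Definition move i k u v w w' : bool :=
  [&& hit w i k u, hit w' i k v & agree i w w'].

Lemma hitP {w i k u} : reflect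
  ((i + c <= n)%N /\ forall j p, p = (i + j)%N :> nat -> w p = (k + u j)%N :> nat)
  (hit w i k u).
Proof.
apply: (iffP andP) => -[le_n hw]; split=> //.
  by move=> j p e; apply/eqP; move/forallP/(_ j)/forallP/(_ p)/implyP: hw; apply; apply/eqP.
by apply/forallP=> j; apply/forallP=> p; apply/implyP=> /eqP /hw ->.
Qed.

Lemma agreeP {i w w'} : reflect
  (forall p, ~~ (i <= p < i + c)%N -> w p = w' p) (agree i w w').
Proof.
apply: (iffP forallP) => h p; last by case: (boolP (_ && _)) => //= /h ->.
by move=> hp; move: (h p); rewrite (negPf hp) => /eqP.
Qed.

Lemma agreeC i w w' : agree i w w' = agree i w' w.
Proof. by apply: eq_forallb => p; rewrite eq_sym. Qed.

Lemma hit_offset p i : (i <= p < i + c)%N -> exists j : 'I_c, p = (i + j)%N :> nat.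
Proof.
by move=> hp; have h : (p - i < c)%N by [lia]; exists (Ordinal h) => /=; lia.
Qed.

Lemma hit_at w i k u j : hit w i k u ->
  exists2 p : 'I_n, p = (i + j)%N :> nat & w p = (k + u j)%N :> nat.
Proof.
case/hitP=> le_n hw; have h : (i + j < n)%N by have := ltn_ord j; lia.
by exists (Ordinal h) => //; apply: hw.
Qed.

(** As [u] is onto, all [c] values of the interval occur inside the window, and injectivity of [w]
    leaves none for other positions. *)
Lemma hit_window w i k u p : hit w i k u ->
  (i <= p < i + c)%N = (k <= w p < k + c)%N.
Proof.
move=> hw; apply/idP/idP=> hp.
  have [j e] := hit_offset hp; have [_ /(_ j p e) ->] := hitP hw.
  by have := ltn_ord (u j); lia.
have h : (w p - k < c)%N by lia.
have [q eq wq] := hit_at (u^-1%g (Ordinal h)) hw.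
have : w q = w p by apply: val_inj; rewrite /= wq permKV /=; lia.
by move/perm_inj<-; rewrite eq; have := ltn_ord (u^-1%g (Ordinal h)); lia.
Qed.

Lemma hit_le_n w i k u : hit w i k u -> (i < n)%N /\ (k < n)%N.
Proof.
move=> hw; have [le_n _] := hitP hw.
have [q eq wq] := hit_at (Ordinal c_gt0) hw.
by have := ltn_ord (w q); lia.
Qed.

(** The base [k] is the least letter of the window, found where the form takes the value 0; it is
    thus determined, and then so is the form. *)
Lemma hit_inj w i k k' u u' : hit w i k u -> hit w i k' u' -> k = k' /\ u = u'.
Proof.
move=> hw hw'.
have wle a b s t : hit w i a s -> hit w i b t -> (a <= b)%N.
  move=> h h'; have [q eq wq] := hit_at (t^-1%g (Ordinal c_gt0)) h'.
  have : (a <= w q < a + c)%N.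
    by rewrite -(hit_window _ h) eq; have := ltn_ord (t^-1%g (Ordinal c_gt0)); lia.
  by rewrite wq permKV /=; lia.
have ek : k = k' by apply/eqP; rewrite eqn_leq (wle _ _ _ _ hw hw') (wle _ _ _ _ hw' hw).
split=> //; apply/permP=> j; apply: val_inj.
have [q eq wq] := hit_at j hw; have [_ /(_ j q eq)] := hitP hw'.
by rewrite wq ek => /addnI.
Qed.

Lemma move_exists w i k u v : hit w i k u -> exists w', move i k u v w w'.
Proof.
move=> hw; have [le_n hwE] := hitP hw.
(* The default of [insubd] is never reached: [k + v j] is already a letter of the hit, hence below
   [n]. *)
pose f (p : 'I_n) : 'I_n :=
  if (i <= p)%N then
    if insub (p - i)%N is Some j then insubd (w p) (k + v (j : 'I_c))%N else w p
  else w p.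
have fin j p : p = (i + j)%N :> nat -> f p = (k + v j)%N :> nat.
  move=> e; rewrite /f e leq_addr addKn valK insubdK //.
  have [q eq wq] := hit_at (u^-1%g (v j)) hw.
  by rewrite unfold_in /=; move: (ltn_ord (w q)); rewrite wq permKV.
have fout p : ~~ (i <= p < i + c)%N -> f p = w p.
  by rewrite /f; case: ifP => // le_ip /= ?; rewrite insubN //; lia.
have f_inj : injective f.
  move=> p q e; case: (boolP (i <= p < i + c)%N) => hp; case: (boolP (i <= q < i + c)%N) => hq.
  - have [a ea] := hit_offset hp; have [b eb] := hit_offset hq.
    move/(congr1 val): e; rewrite /= (fin _ _ ea) (fin _ _ eb) => /addnI/val_inj/perm_inj ab.
    by apply: val_inj; rewrite /= ea eb ab.
  - have [a ea] := hit_offset hp; move: (hq); rewrite (hit_window _ hw) -(fout _ hq) -e (fin _ _ ea).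
    by have := ltn_ord (v a); lia.
  - have [a ea] := hit_offset hq; move: (hp); rewrite (hit_window _ hw) -(fout _ hp) e (fin _ _ ea).
    by have := ltn_ord (v a); lia.
  - by move: e; rewrite !fout // => /perm_inj.
exists (perm f_inj); apply/and3P; split=> //.
  by apply/hitP; split=> // j p /fin; rewrite permE.
by apply/agreeP=> p /fout; rewrite permE.
Qed.

Lemma move_inj w i k u v w1 w2 : move i k u v w w1 -> move i k u v w w2 -> w1 = w2.
Proof.
case/and3P=> _ /hitP[_ h1] /agreeP a1 /and3P[_ /hitP[_ h2] /agreeP a2].
apply/permP=> p; case: (boolP (i <= p < i + c)%N) => hp; last by rewrite -a1 // a2.
have [a ea] := hit_offset hp; apply: val_inj.
by rewrite /= (h1 _ _ ea) (h2 _ _ ea).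
Qed.

Definition apart i i' := (i + c <= i')%N || (i' + c <= i)%N.

Lemma agree_hit w w' i i' k u : apart i i' -> agree i' w w' ->
  hit w i k u -> hit w' i k u.
Proof.
move=> ap /agreeP a /hitP[le_n h]; apply/hitP; split=> // j p e.
rewrite -a; first exact: h.
by have := ltn_ord j; move: ap; rewrite /apart; lia.
Qed.

Lemma size_subword w i : (i + c <= n)%N -> size (subword c (word w) i) = c.
Proof. by move=> le_n; rewrite size_takel // size_drop size_word; lia. Qed.

Lemma subword_hit w i k u : hit w i k u ->
  subword c (word w) i = [seq x + k%:Z | x <- word u].
Proof.
move=> hw; have [le_n hwE] := hitP hw.
apply: (@eq_from_nth _ 0); first by rewrite size_map size_subword // size_word.
move=> a; rewrite size_subword // => ha.
rewrite (nth_map 0) ?size_word // nth_take // nth_drop.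
have [q eq wq] := hit_at (Ordinal ha) hw.
rewrite -[a]/(val (Ordinal ha)) -eq !nth_word wq.
by lia.
Qed.

Lemma formsP w i u : forms (subword c (word w) i) u <-> exists k, hit w i k u.
Proof.
split=> [[k e]|[k /subword_hit e]]; last by exists k%:Z.
have le_n : (i + c <= n)%N.
  move: (congr1 size e); rewrite size_map size_word size_take size_drop size_word.
  by case: ifP; lia.
have wE j p : p = (i + j)%N :> nat -> (w p).+1%:Z = (u j).+1%:Z + k.
  move=> ep; rewrite -!nth_word -(nth_map 0 0 (fun x => x + k)) ?size_word // -e.
  by rewrite nth_take // nth_drop ep.
(* Where [u] takes its least value the letter of [w] is [1 + k], so the integer [k] is
   nonnegative. *)
have h0 : (i + u^-1%g (Ordinal c_gt0) < n)%N by have := ltn_ord (u^-1%g (Ordinal c_gt0)); lia.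
have := wE (u^-1%g (Ordinal c_gt0)) (Ordinal h0) erefl; rewrite permKV /= => e0.
exists `|k|%N; apply/hitP; split=> // j p /wE; lia.
Qed.

(** * Polarization in integer arithmetic *)

Definition pol w i : bool := right_polarized c (word w) i.
Definition letter w i : int := nth 0 (word w) i.

Lemma average_hit w i k u : hit w i k u ->
  average (subword c (word w) i) * 2 = (2 * k%:Z + c.+1%:Z)%:~R.
Proof.
move=> hw; rewrite /average (subword_hit hw) size_map size_word big_map.
under eq_bigr => x _ do rewrite intrD.
rewrite big_split /= big_const_seq count_predT size_word iter_addr_0.
have c0 : (c%:R : rat) != 0 by rewrite pnatr_eq0 -lt0n.
rewrite mulrAC mulrDl sum_word -[k%:~R *+ c]mulr_natr.
rewrite intrD intrM -!pmulrn -[c.+1%:R]natr1.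
by field.
Qed.

(** Doubling turns the average into the integer [a]. For a hit that is not the whole word, the flag
    [b] tells whether the left neighbor is the chosen one, and never selects a neighbor that does
    not exist. *)
Lemma polarizedE w i k u (x := letter w i.-1) (y := letter w (i + c))
    (a := 2 * k%:Z + c.+1%:Z)
    (b := (0 < i)%N && ((i + c == n)%N || (`|2 * x - a| <= `|2 * y - a|))) :
  hit w i k u ->
  pol w i = (n != c) && (if b then 2 * x < a else a < 2 * y) /\
  left_polarized c (word w) i = (n == c) || (if b then a < 2 * x else 2 * y < a).
Proof.
move=> hw; have [le_n _] := hitP hw.
rewrite /pol /right_polarized /left_polarized size_word.
have [//|neq_nc /=] := eqVneq n c.
set t := contract _ _ _; set A := average (subword c (word w) i).
have AE : A * 2 = a%:~R := average_hit hw.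
have size_ti : size [seq x%:Q | x <- take i (word w)] = i.
  by rewrite size_map size_takel // size_word; lia.
have size_t : size t = (n - c).+1.
  by rewrite size_cat size_ti /= size_map size_drop size_word; lia.
have tA : nth 0 t i = A by rewrite nth_cat size_ti ltnn subnn.
have tx : (0 < i)%N -> nth 0 t i.-1 = x%:~R.
  move=> i0; rewrite nth_cat size_ti prednK // leqnn (nth_map 0) ?nth_take //; try lia.
  by rewrite size_takel ?size_word; lia.
have ty : (i + c < n)%N -> nth 0 t i.+1 = y%:~R.
  move=> ic; rewrite nth_cat size_ti ltnNge leqnSn /= subSnn /= (nth_map 0).
    by rewrite nth_drop addn0.
  by rewrite size_drop size_word; lia.
have ltA z : ((z%:~R < A) = (2 * z < a)) * ((A < z%:~R) = (a < 2 * z)).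
  have two : (0 : rat) < 2 by [].
  have zE : z%:~R * 2 = (2 * z)%:~R :> rat by rewrite intrM mulrC.
  by split; rewrite -(ltr_pM2r two) zE AE ltr_int.
have nE z : `|z%:~R - A| * 2 = `|2 * z - a|%:~R.
  have zE : z%:~R * 2 = (2 * z)%:~R :> rat by rewrite intrM mulrC.
  by rewrite intr_norm intrB -zE -AE -mulrBl normrM.
have bE : ((0 < i)%N && ((i.+1 == size t) || (`|nth 0 t i.-1 - nth 0 t i| <= `|nth 0 t i.+1 - nth 0 t i|))) = b.
  rewrite /b; case: posnP => //= i0.
  have -> : (i.+1 == size t) = (i + c == n)%N by rewrite size_t; lia.
  case: eqVneq => //= ne; rewrite tA tx // ty; last by lia.
  have two : (0 : rat) < 2 by [].
  by rewrite -(ler_pM2r two) !nE ler_int.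
rewrite /neighbor bE; case: ifP => hb.
  have i0 : (0 < i)%N by move: hb; rewrite /b => /andP[].
  have -> : minn i i.-1 = i.-1 by lia.
  have -> : maxn i i.-1 = i by lia.
  by rewrite tA tx // !ltA.
have ic : (i + c < n)%N.
  by move/negbT: hb; rewrite /b negb_and negb_or; case: (eqVneq (i + c)%N n) => //=; lia.
have -> : minn i i.+1 = i by lia.
have -> : maxn i i.+1 = i.+1 by lia.
by rewrite tA ty // !ltA.
Qed.

(** Letters count from 1 but hits from 0, hence the bounds strict below and weak above. *)
Lemma letter_window w i k u a : hit w i k u -> (a < n)%N ->
  (i <= a < i + c)%N = (k%:Z < letter w a <= (k + c)%N%:Z).
Proof.
move=> hw ha; rewrite /letter -[a]/(val (Ordinal ha)) nth_word.
by rewrite (hit_window _ hw) !lez_nat.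
Qed.

Lemma agree_letter w w' i a : agree i w w' -> ~~ (i <= a < i + c)%N ->
  letter w a = letter w' a.
Proof.
move=> /agreeP h ha; case: (ltnP a n) => [lt_an|le_na].
  by rewrite /letter -[a]/(val (Ordinal lt_an)) !nth_word h.
by rewrite /letter !nth_default ?size_word.
Qed.

(** A neighbor lies outside the interval of values of the hit and the average inside it, so they are
    never equal. *)
Lemma left_polarizedE w i k u : hit w i k u ->
  left_polarized c (word w) i = ~~ pol w i.
Proof.
move=> hw; have [le_n _] := hitP hw; have [-> ->] := polarizedE hw.
have [//|neq_nc /=] := eqVneq n c.
case: ifP => hb.
  have i0 : (0 < i)%N by case/andP: hb.
  have := @letter_window w i k u i.-1 hw; lia.
have ic : (i + c < n)%N.
  by move/negbT: hb; rewrite negb_and negb_or; case: (eqVneq (i + c)%N n) => //=; lia.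
by have := letter_window hw ic; lia.
Qed.

(** By [polarizedE] the polarization depends only on [i], [k] and letters outside the window. *)
Lemma pol_move w w' i k u v : move i k u v w w' -> pol w' i = pol w i.
Proof.
case/and3P=> hw hw' ag.
have [-> _] := polarizedE hw; have [-> _] := polarizedE hw'.
have -> : letter w (i + c) = letter w' (i + c).
  by apply: (agree_letter ag); lia.
case: (posnP i) => [->//|i0].
by have -> : letter w i.-1 = letter w' i.-1 by apply: (agree_letter ag); lia.
Qed.

(** Only a rearranged hit next to the window can change a neighbor. The new neighbor stays in an
    interval of values that misses the average, so the [closest_stable] lemmas apply. *)
Lemma pol_apart w w' i k u i' k' u' v' : apart i i' ->
  hit w i k u -> move i' k' u' v' w w' -> pol w' i = pol w i.
Proof.
move=> ap hw mw; have /and3P[h1 h2 ag] := mw.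
have hw' := agree_hit ap ag hw.
have [-> _] := polarizedE hw; have [-> _] := polarizedE hw'.
have [le_n _] := hitP hw; have [le_n' _] := hitP h1.
congr (_ && _).
(* The least letter of each hit lies outside the other window, so the two intervals of values are
   disjoint. *)
have kk : (k + c <= k')%N || (k' + c <= k)%N.
  have [p ep wp] := hit_at (u^-1%g (Ordinal c_gt0)) hw.
  have [q eq wq] := hit_at (u'^-1%g (Ordinal c_gt0)) h1.
  rewrite permKV /= in wp; rewrite permKV /= in wq.
  have := hit_window p h1; have := hit_window q hw.
  rewrite wp wq ep eq; move: ap; rewrite /apart.
  have := ltn_ord (u^-1%g (Ordinal c_gt0)); have := ltn_ord (u'^-1%g (Ordinal c_gt0)).
  by clear; lia.
have far : (2 * k%:Z + c.+1%:Z <= 2 * k'%:Z) || (2 * (k' + c)%N%:Z < 2 * k%:Z + c.+1%:Z).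
  by move: kk c_gt0; clear; lia.
have [ei|ni] := eqVneq i' (i + c)%N.
  have lt_n : (i + c < n)%N by move: le_n' c_gt0; rewrite ei; clear; lia.
  have in' : (i' <= i + c < i' + c)%N by move: c_gt0; rewrite ei; clear; lia.
  have := letter_window h1 lt_n; rewrite in' => /esym y1.
  have := letter_window h2 lt_n; rewrite in' => /esym y2.
  rewrite (ltn_eqF lt_n) /=; case: (posnP i) => [_|i0] /=.
    by move: y1 y2 far; clear; lia.
  have nx : ~~ (i' <= i.-1 < i' + c)%N by move: i0; rewrite ei; clear; lia.
  rewrite -(agree_letter ag nx); apply/esym/(closest_stable_right far y1 y2).
  by rewrite -(letter_window h1) //; move: lt_n; clear; lia.
have ny : ~~ (i' <= i + c < i' + c)%N by move: ap ni; rewrite /apart; clear; lia.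
rewrite -(agree_letter ag ny).
have [ei|ni'] := eqVneq (i' + c)%N i.
  have i0 : (0 < i)%N by move: c_gt0; rewrite -ei; clear; lia.
  have lt_n : (i.-1 < n)%N by move: le_n c_gt0; clear; lia.
  have in' : (i' <= i.-1 < i' + c)%N by move: c_gt0; rewrite -ei; clear; lia.
  have := letter_window h1 lt_n; rewrite in' => /esym x1.
  have := letter_window h2 lt_n; rewrite in' => /esym x2.
  rewrite i0 /=; have [ic|ic] := eqVneq (i + c)%N n => /=.
    by move: x1 x2 far; clear; lia.
  apply/esym/(closest_stable_left far x1 x2).
  by rewrite -(letter_window h1) //; move: ic le_n; clear; lia.
case: (posnP i) => [//|i0].
have nx : ~~ (i' <= i.-1 < i' + c)%N by move: ap ni'; rewrite /apart; clear; lia.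
by rewrite -(agree_letter ag nx).
Qed.

(* The order of the two intervals of values decides both leanings and both
   polarizations. *)
Lemma overlap_forward w i k u i' k' u' :
  hit w i k u -> hit w i' k' u' -> (i < i' < i + c)%N ->
  exists b, [/\ u \in side c b, u' \in side c b, pol w i = b & pol w i' = b].
Proof.
move=> hw hw' lt_ii; have [le_n _] := hitP hw; have [le_n' _] := hitP hw'.
have W j : (i' <= i + j < i' + c)%N = (k' <= k + u j < k' + c)%N.
  by have [p <- <-] := hit_at j hw; apply: hit_window hw'.
have W' j : (i <= i' + j < i + c)%N = (k <= k' + u' j < k + c)%N.
  by have [p <- <-] := hit_at j hw'; apply: hit_window hw.
(* The first letter of the later window lies in both intervals, that of the earlier window only in
   its own: the intervals meet and differ. *)
have kk : [&& k != k', k <= k' + c & k' <= k + c]%N.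
  have h0 := W' (Ordinal c_gt0); have ub := ltn_ord (u' (Ordinal c_gt0)).
  have h1 := W (Ordinal c_gt0); have ub1 := ltn_ord (u (Ordinal c_gt0)).
  by move: h0 h1 ub ub1 lt_ii => /=; move: (u' _) (u _) => a b; clear; lia.
have lt_n : (i + c < n)%N by move: lt_ii le_n'; clear; lia.
have neq_nc : n != c by move: lt_n; clear; lia.
have [-> _] := polarizedE hw; have [-> _] := polarizedE hw'; rewrite neq_nc /=.
(* The right neighbor lies in the other interval and the left one outside both, so when they are on
   the same side of the average the right one is nearer. *)
have polu : (if (0 < i)%N && ((i + c == n)%N ||
     (`|2 * letter w i.-1 - (2 * k%:Z + c.+1%:Z)| <= `|2 * letter w (i + c) - (2 * k%:Z + c.+1%:Z)|))
   then 2 * letter w i.-1 < 2 * k%:Z + c.+1%:Z else 2 * k%:Z + c.+1%:Z < 2 * letter w (i + c)) = (k < k')%N.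
  have y1 : ~~ (k%:Z < letter w (i + c) <= (k + c)%N%:Z).
    by rewrite -(letter_window hw lt_n); clear; lia.
  have y2 : k'%:Z < letter w (i + c) <= (k' + c)%N%:Z.
    by rewrite -(letter_window hw' lt_n); move: lt_ii; clear; lia.
  case: (posnP i) => [_|i0] /=; first by move: y1 y2 kk; clear; lia.
  have i1n : (i.-1 < n)%N by move: le_n c_gt0; clear; lia.
  have x1 : ~~ (k%:Z < letter w i.-1 <= (k + c)%N%:Z).
    by rewrite -(letter_window hw i1n); move: i0; clear; lia.
  have x2 : ~~ (k'%:Z < letter w i.-1 <= (k' + c)%N%:Z).
    by rewrite -(letter_window hw' i1n); move: lt_ii i0; clear; lia.
  rewrite (ltn_eqF lt_n) /=; move: y1 y2 x1 x2 kk; clear => *.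
  by case: ifP => ?; apply/idP/idP; lia.
have polu' : (if (0 < i')%N && ((i' + c == n)%N ||
     (`|2 * letter w i'.-1 - (2 * k'%:Z + c.+1%:Z)| <= `|2 * letter w (i' + c) - (2 * k'%:Z + c.+1%:Z)|))
   then 2 * letter w i'.-1 < 2 * k'%:Z + c.+1%:Z else 2 * k'%:Z + c.+1%:Z < 2 * letter w (i' + c)) = (k < k')%N.
  have i0 : (0 < i')%N by move: lt_ii; clear; lia.
  have i1n : (i'.-1 < n)%N by move: le_n' c_gt0; clear; lia.
  have x1 : k%:Z < letter w i'.-1 <= (k + c)%N%:Z.
    by rewrite -(letter_window hw i1n); move: lt_ii i0; clear; lia.
  have x2 : ~~ (k'%:Z < letter w i'.-1 <= (k' + c)%N%:Z).
    by rewrite -(letter_window hw' i1n); move: i0; clear; lia.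
  rewrite i0 /=; have [ic|ic] := eqVneq (i' + c)%N n => /=.
    by move: x1 x2 kk; clear; lia.
  have lt_n' : (i' + c < n)%N by move: ic le_n'; clear; lia.
  have y1 : ~~ (k%:Z < letter w (i' + c) <= (k + c)%N%:Z).
    by rewrite -(letter_window hw lt_n'); move: lt_ii; clear; lia.
  have y2 : ~~ (k'%:Z < letter w (i' + c) <= (k' + c)%N%:Z).
    by rewrite -(letter_window hw' lt_n'); clear; lia.
  move: y1 y2 x1 x2 kk; clear => *.
  by case: ifP => ?; apply/idP/idP; lia.
(* The common values are the top of one interval and the bottom of the other, so each form is cut at
   the border of the overlap: after [i' - i] letters of [u], after [i + c - i'] letters of [u']. *)
exists (k < k')%N; rewrite polu polu'; case: (ltnP k k') => [lt_k|le_k]; split=> //.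
- rewrite inE; apply: (@right_leaning_word _ _ (i' - i)%N) => [|p q pq].
    by move: lt_ii; clear; lia.
  move: (W p) (W q) (ltn_ord p) (ltn_ord q) (ltn_ord (u p)) (ltn_ord (u q)) pq lt_ii lt_k kk.
  by move: (u p) (u q) => a b; clear; lia.
- rewrite inE; apply: (@right_leaning_word _ _ (i + c - i')%N) => [|p q pq].
    by move: lt_ii; clear; lia.
  move: (W' p) (W' q) (ltn_ord p) (ltn_ord q) (ltn_ord (u' p)) (ltn_ord (u' q)) pq lt_ii lt_k kk.
  by move: (u' p) (u' q) => a b; clear; lia.
- rewrite inE; apply: (@left_leaning_word _ _ (i' - i)%N) => [|p q pq].
    by move: lt_ii; clear; lia.
  move: (W p) (W q) (ltn_ord p) (ltn_ord q) (ltn_ord (u p)) (ltn_ord (u q)) pq lt_ii le_k kk.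
  by move: (u p) (u q) => a b; clear; lia.
- rewrite inE; apply: (@left_leaning_word _ _ (i + c - i')%N) => [|p q pq].
    by move: lt_ii; clear; lia.
  move: (W' p) (W' q) (ltn_ord p) (ltn_ord q) (ltn_ord (u' p)) (ltn_ord (u' q)) pq lt_ii le_k kk.
  by move: (u' p) (u' q) => a b; clear; lia.
Qed.

(** * Straightening as a step towards a target *)

Hypothesis disjRL : [disjoint Rset c & Lset c].

Definition leaning : {set 'S_c} := Rset c :|: Lset c.

Lemma side_neg b u : u \in side c b -> u \notin side c (~~ b).
Proof.
by case: b => /= h; [rewrite (disjointFr disjRL h) | rewrite (disjointFl disjRL h)].
Qed.

Lemma side_inj b b' u : u \in side c b -> u \in side c b' -> b = b'.
Proof.
move=> ub; case: (eqVneq b b') => // nb; have -> : b' = ~~ b by case: b b' nb {ub} => [] [].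
by rewrite (negPf (side_neg ub)).
Qed.

Lemma leaning_side b u : u \in side c b -> u \in leaning.
Proof. by rewrite inE; case: b => ->; rewrite ?orbT. Qed.

Lemma leaningN b u : u \in leaning -> u \notin side c b -> u \in side c (~~ b).
Proof. by case: b; rewrite inE => /orP[] //= ->. Qed.

(** Disjointness of the two sides and [left_polarizedE] reduce the three cases of [backward] to one
    comparison. *)
Lemma forwardE w i k u : hit w i k u -> u \in leaning ->
  forward c (word w) i = (u \in side c (pol w i)).
Proof.
move=> hw u_lean; rewrite /forward /backward (left_polarizedE hw) -/(pol w i).
rewrite /omni_leaning (subword_hit hw) right_leaning_shift left_leaning_shift.
have uR : right_leaning (word u) = (u \in side c true) by rewrite inE.
have uL : left_leaning (word u) = (u \in side c false) by rewrite inE.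
rewrite uR uL; have := @side_neg true u; have := @leaningN true u u_lean => /=.
by case: (pol w i); case: (u \in Rset c); case: (u \in Lset c) => //=; auto.
Qed.

(* The form of u after straightening a hit which is right polarized iff b; the
   default 1 is never reached. *)
Definition target (V : {set {set 'S_c}}) (D : {set 'S_c}) (b : bool) u : 'S_c :=
  let X := pblock V u in
  odflt 1%g [pick v in D :&: X :&: side c (b (+) (X :&: side c b == set0))].

(** Ordinal quantifiers make this a boolean relation; [hit_le_n] shows that they miss no hit. *)
Definition step (T : bool -> 'S_c -> 'S_c) (S : {set 'S_c}) w w' : bool :=
  [exists i : 'I_n, exists k : 'I_n, exists u : 'S_c,
    [&& u \in S, T (pol w i) u != u & move i k u (T (pol w i) u) w w']].

Lemma stepP T (S : {set 'S_c}) w w' : reflect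
  (exists i k u, [/\ u \in S, T (pol w i) u != u & move i k u (T (pol w i) u) w w'])
  (step T S w w').
Proof.
apply: (iffP existsP) => [[i /existsP[k /existsP[u /and3P h]]]|[i [k [u [uS Tu mw]]]]].
  by exists i, k, u.
have /and3P[hw _ _] := mw; have [lt_i lt_k] := hit_le_n hw.
exists (Ordinal lt_i); apply/existsP; exists (Ordinal lt_k); apply/existsP; exists u.
exact/and3P.
Qed.

Section Target.
Variables (V : {set {set 'S_c}}) (S D : {set 'S_c}).
Hypotheses (partV : partition V S) (S_lean : S \subset leaning).
Hypothesis uniqD : forall X b, X \in V -> X :&: side c b != set0 ->
  #|D :&: X :&: side c b| = 1%N.

Lemma block_in u : u \in S -> pblock V u \in V.
Proof. by move=> uS; rewrite pblock_mem // (cover_partition partV). Qed.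

Lemma in_block u : u \in S -> u \in pblock V u.
Proof. by move=> uS; rewrite mem_pblock (cover_partition partV). Qed.

Lemma block_eq u v : v \in pblock V u -> pblock V v = pblock V u.
Proof. by apply: same_pblock; case/and3P: partV. Qed.

Lemma block_sub u v : u \in S -> v \in pblock V u -> v \in S.
Proof.
move=> uS vu; rewrite -(cover_partition partV) -mem_pblock (block_eq vu) //.
Qed.

Lemma target_block b u v : v \in pblock V u -> target V D b v = target V D b u.
Proof. by move=> vu; rewrite /target (block_eq vu). Qed.

(** The exclusive or selects side [b] if the part meets it and the other side otherwise; since [u]
    is leaning, the part meets the selected side. *)
Lemma target_card b u : u \in S ->
  #|D :&: pblock V u :&: side c (b (+) (pblock V u :&: side c b == set0))| = 1%N.
Proof.
move=> uS; apply: uniqD; first exact: block_in.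
have [X0|] := eqVneq (pblock V u :&: side c b) set0; last by rewrite addbF.
rewrite addbT; apply/set0Pn; exists u; rewrite inE in_block //=.
apply: leaningN; first exact: (subsetP S_lean).
by apply/negP=> ub; have := in_set0 u; rewrite -X0 inE in_block // ub.
Qed.

Lemma target_in b u (v := target V D b u) : u \in S ->
  [/\ v \in D, v \in pblock V u & v \in side c (b (+) (pblock V u :&: side c b == set0))].
Proof.
move=> /(target_card b) card1; rewrite /v /target; case: pickP => [x|x0] /=.
  by rewrite !inE -andbA => /and3P.
by rewrite eq_card0 in card1.
Qed.

Lemma target_eq b u v : u \in S -> v \in D -> v \in pblock V u ->
  v \in side c (b (+) (pblock V u :&: side c b == set0)) -> target V D b u = v.
Proof.
move=> uS vD vX vb; have /eqP/cards1P[x Ex] := target_card b uS.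
have [tD tX tb] := target_in b uS.
have : v \in D :&: pblock V u :&: side c (b (+) (pblock V u :&: side c b == set0)).
  by rewrite !inE vD vX.
have : target V D b u \in D :&: pblock V u :&: side c (b (+) (pblock V u :&: side c b == set0)).
  by rewrite !inE tD tX.
by rewrite Ex !inE => /eqP-> /eqP->.
Qed.

Lemma target_id b u v : u \in S -> v \in pblock V u -> v \in D -> v \in side c b ->
  target V D b u = v.
Proof.
move=> uS vX vD vb; apply: target_eq => //.
rewrite (_ : _ == _ = false) ?addbF //.
by apply/set0Pn; exists v; rewrite inE vX.
Qed.

Lemma P_rearrangementP w i w' : P_rearrangement V w i w' <->
  exists k u v, [/\ u \in S, v \in pblock V u & move i k u v w w'].
Proof.
have trivV : trivIset V by case/and3P: partV.
split=> [[e1 e2 e3 [X [u [v [XV uX vX]]]]]|[k [u [v [uS vu mw]]]]].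
  move=> /formsP[k hu] /formsP[k' hv].
  have uS : u \in S by rewrite -(cover_partition partV); apply/bigcupP; exists X.
  have [le_n _] := hitP hu.
  have ag : agree i w w'.
    apply/agreeP=> p hp; apply: val_inj.
    suff : nth 0 (word w) p = nth 0 (word w') p by rewrite !nth_word => -[].
    case: (ltnP p i) => [lt_pi|le_ip]; first by rewrite -(nth_take 0 lt_pi (word w)) -e1 nth_take.
    have le_icp : (i + c <= p)%N by move: hp; rewrite le_ip /=; clear; lia.
    by rewrite -(subnKC le_icp) -!nth_drop e2.
  have mem_k a s x : hit x i a s -> (k.+1%:Z \in subword c (word x) i) -> (a <= k)%N.
    by move=> /subword_hit-> /mapP[y /mapP[z _ ->]]; clear; lia.
  have mem_k' a s x : hit x i a s -> a.+1%:Z \in subword c (word x) i.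
    move=> /subword_hit->; apply/mapP; exists 1%Z; last by clear; lia.
    apply/mapP; exists (s^-1%g (Ordinal c_gt0)); first by rewrite mem_enum.
    by rewrite permKV.
  (* Both subwords have the same letters, hence the same least letter. *)
  have kk : k' = k.
    apply/eqP; rewrite eqn_leq (mem_k _ _ _ hv) ?(perm_mem e3) ?(mem_k' _ _ _ hu) //=.
    have := mem_k' _ _ _ hv; rewrite (perm_mem e3) (subword_hit hu).
    by case/mapP=> y /mapP[z _ ->]; clear; lia.
  exists k, u, v; split=> //; first by rewrite (def_pblock trivV XV uX).
  by apply/and3P; rewrite -{2}kk.
have /and3P[hu hv /agreeP ag] := mw; have [le_n _] := hitP hu.
have ag' a : ~~ (i <= a < i + c)%N -> nth 0 (word w) a = nth 0 (word w') a.
  by move=> ha; apply: (@agree_letter w w' i) => //; apply/agreeP.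
split.
- apply: (@eq_from_nth _ 0); first by rewrite !size_take !size_word.
  move=> a ha; have lt_ai : (a < i)%N by move: ha; rewrite size_take; clear; case: ifP; lia.
  by rewrite !nth_take // ag' //; move: lt_ai; clear; lia.
- apply: (@eq_from_nth _ 0); first by rewrite !size_drop !size_word.
  by move=> a _; rewrite !nth_drop ag' //; clear; lia.
- rewrite (subword_hit hu) (subword_hit hv); apply: perm_map.
  have wordE s : perm_eq (@word c s) [seq (j.+1)%:Z | j : 'I_c <- enum 'I_c].
    rewrite /word (map_comp (fun j : 'I_c => j.+1%:Z) s); apply: perm_map.
    apply: uniq_perm; rewrite ?(map_inj_uniq perm_inj) ?enum_uniq //.
    move=> j; rewrite mem_enum; apply/mapP; exists (s^-1%g j); rewrite ?mem_enum //.
    by rewrite permKV.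
  by apply: perm_trans (wordE v) _; rewrite perm_sym.
- exists (pblock V u), u, v; rewrite block_in ?in_block //; split=> //.
    by apply/formsP; exists k.
  by apply/formsP; exists k.
Qed.

Lemma straightenedE w i k u : hit w i k u -> u \in S ->
  straightened V D w i <-> target V D (pol w i) u = u.
Proof.
move=> hw uS; have u_lean := subsetP S_lean u uS.
have uX := in_block uS.
split=> [[[s sD /formsP[k' hs]]]|tu].
  have [_ us] := hit_inj hw hs; rewrite -{s hs}us in sD *.
  case: (boolP (u \in side c (pol w i))) => [ub _|ub].
    exact: target_id.
  case=> [fw|[_ no_fw]]; first by move: fw; rewrite (forwardE hw) // (negPf ub).
  apply: target_eq => //; case: eqP => [_|/eqP/set0Pn[v]].
    by rewrite addbT; apply: leaningN.
  (* A form in the part on the side of the polarization would give a forward rearrangement, against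
     [no_fw]. *)
  rewrite inE => /andP[vX vb]; have [w' mw] := move_exists v hw; exfalso.
  have re : P_rearrangement V w i w' by apply/P_rearrangementP; exists k, u, v.
  apply: (no_fw _ re); have /and3P[_ hv _] := mw.
  by rewrite (forwardE hv) ?(pol_move mw) //; apply: (leaning_side vb).
have [tD _ tb] := target_in (pol w i) uS; rewrite tu in tD tb.
split; first by exists u => //; apply/formsP; exists k.
case: eqP tb => [X0|_]; last by rewrite addbF => ub; left; rewrite (forwardE hw).
rewrite addbT => ub; right; split.
  rewrite -[backward _ _ _]negbK -/(forward _ _ _) (forwardE hw) //.
  by rewrite -[pol w i]negbK side_neg.
move=> w' /P_rearrangementP[k' [u' [v [u'S vu mw]]]].
have /and3P[hu' hv _] := mw; have [_ e] := hit_inj hw hu'; rewrite -{u' hu'}e in u'S vu mw *.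
have v_lean := subsetP S_lean v (block_sub uS vu).
rewrite (forwardE hv) // (pol_move mw) => vb.
by have := in_set0 v; rewrite -X0 inE vu vb.
Qed.

Lemma straighteningE w w' : straightening V D w w' <-> step (target V D) S w w'.
Proof.
have trivV : trivIset V by case/and3P: partV.
split=> [[i [_ ns /P_rearrangementP[k [u [v [uS vu mw]]]] st]]|].
  have /and3P[hu hv _] := mw.
  move: st; rewrite (straightenedE hv (block_sub uS vu)) (pol_move mw) (target_block _ vu) => tv.
  apply/stepP; exists i, k, u; rewrite tv; split=> //.
  by apply/eqP=> e; apply: ns; apply/(straightenedE hu uS); rewrite tv.
case/stepP=> i [k [u [uS tu mw]]]; have /and3P[hu hv _] := mw.
have [_ tX _] := target_in (pol w i) uS.
exists i; split.
- by exists u; rewrite ?(cover_partition partV) //; apply/formsP; exists k.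
- by rewrite (straightenedE hu uS); apply/eqP.
- by apply/P_rearrangementP; exists k, u, (target V D (pol w i) u).
- by apply/(straightenedE hv (block_sub uS tX)); rewrite (pol_move mw) (target_block _ tX).
Qed.

End Target.

(** * Disjoint hits and commuting moves *)

Lemma apartC i i' : apart i i' = apart i' i.
Proof. by rewrite /apart orbC. Qed.

Lemma not_apart w i k u i' k' u' : hit w i k u -> hit w i' k' u' -> i != i' ->
  ~~ apart i i' ->
  exists b, [/\ u \in side c b, u' \in side c b, pol w i = b & pol w i' = b].
Proof.
move=> hw hw' ni; rewrite negb_or -!ltnNge => /andP[lt1 lt2].
case: (ltngtP i i') ni => // lt_ii _.
  by apply: (overlap_forward hw hw'); rewrite lt_ii.
have [|b [? ? ? ?]] := overlap_forward hw' hw; first by rewrite lt_ii.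
by exists b.
Qed.

Lemma sides_apart w i k u i' k' u' b : hit w i k u -> hit w i' k' u' ->
  u \in side c (~~ b) -> u' \in side c b -> apart i i'.
Proof.
move=> hw hw' ub u'b; have [eq_i|ni] := eqVneq i i'.
  rewrite -eq_i in hw'; have [_ e] := hit_inj hw hw'.
  by move: u'b; rewrite -e => /side_neg; rewrite ub.
apply/negPn/negP=> /(not_apart hw hw' ni)[b' [ub' u'b' _ _]].
by have := side_inj ub ub'; rewrite (side_inj u'b u'b'); case: (b').
Qed.

Lemma move_trans w i k u v s x y : move i k u v w x -> move i k u s w y ->
  move i k v s x y.
Proof.
move=> /and3P[_ hx /agreeP ax] /and3P[_ hy /agreeP ay]; apply/and3P; split=> //.
by apply/agreeP=> p hp; rewrite -ax // ay.
Qed.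

(** The fourth side of the commuting square of two moves at disjoint windows. *)
Lemma move_square w i k u v x i' k' s t y z : apart i i' ->
  move i k u v w x -> move i' k' s t w y -> move i k u v y z ->
  move i' k' s t x z.
Proof.
move=> ap /and3P[hw hx ax] /and3P[hw' hy ay] /and3P[hy' hz az].
apply/and3P; split.
- by apply: agree_hit ax hw'; rewrite apartC.
- by apply: agree_hit az hy; rewrite apartC.
apply/agreeP=> p hp; case: (boolP (i <= p < i + c)%N) => hpi.
  have [j e] := hit_offset hpi; apply: val_inj => /=.
  by have [_ /(_ j p e) ->] := hitP hx; have [_ /(_ j p e) ->] := hitP hz.
by rewrite -(agreeP ax) // -(agreeP az) // (agreeP ay).
Qed.

(** * Termination and confluence *)

Section Operator.
(** An abstraction of [target]: in [T_flip] the first case models parts on one side, the second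
    parts meeting both, and [T_comp] reflects that all forms of a part have the same targets. *)
Variable T : bool -> 'S_c -> 'S_c.
Hypothesis T_side : forall b u, u \in side c b -> T b u \in side c b.
Hypothesis T_flip : forall b u, u \in side c b ->
  T (~~ b) u = T b u \/ T (~~ b) u \in side c (~~ b).
Hypothesis T_comp : forall b b' u, u \in leaning -> T b' (T b u) = T b' u.

(** Models straightening for the partition of side [b] alone: its parts lie on one side, so both
    polarizations have the same target. *)
Definition side_step b : rel 'S_n := step (fun=> T b) (side c b).

Hypothesis side_confluent : forall b, confluent (side_step b).

(* A backward hit that straightening turns into a forward one. *)
Definition mixed_backward w i : bool :=
  [exists k : 'I_n, exists u : 'S_c,
    [&& hit w i k u, u \in side c (~~ pol w i) & T (pol w i) u \in side c (pol w i)]].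

Lemma mixed_backwardP w i : reflect
  (exists k u, [/\ hit w i k u, u \in side c (~~ pol w i) & T (pol w i) u \in side c (pol w i)])
  (mixed_backward w i).
Proof.
apply: (iffP existsP) => [[k /existsP[u /and3P h]]|[k [u [hw u1 u2]]]].
  by exists k, u.
have [_ lt_k] := hit_le_n hw.
by exists (Ordinal lt_k); apply/existsP; exists u; apply/and3P.
Qed.

(** At the moved hit the polarization is kept and [T_side] applies; at a disjoint hit [pol_apart]
    does; a hit overlapping the moved one is forward. The disjunction covers both actual steps and
    side steps. *)
Lemma mixed_backward_move b i k u w w' a : u \in leaning ->
  (b = pol w i \/ u \in side c b) -> move i k u (T b u) w w' ->
  mixed_backward w' a -> mixed_backward w a.
Proof.
move=> u_lean hb mw /mixed_backwardP[k' [v [hv v1 v2]]].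
have /and3P[hw hw' ag] := mw; have [ea|na] := eqVneq i a.
  move: hv v1 v2; rewrite -ea (pol_move mw) => hv v1 v2.
  have [_ e] := hit_inj hw' hv; rewrite -e in hv v1 v2.
  apply/mixed_backwardP; exists k, u; split=> //; last by rewrite T_comp // in v2.
  apply: leaningN => //; apply/negP=> ub.
  have eb : b = pol w i.
    by case: hb => // /side_inj; apply.
  by have := side_neg (T_side ub); rewrite -{1}eb v1.
have [ap|nap] := boolP (apart i a).
  have hv0 : hit w a k' v.
    by rewrite agreeC in ag; apply: agree_hit ag hv; rewrite apartC.
  have ep : pol w' a = pol w a by apply: (pol_apart _ hv0 mw); rewrite apartC.
  by apply/mixed_backwardP; exists k', v; rewrite -ep.
have [b' [_ vb' _ pb']] := not_apart hw' hv na nap.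
by move: v1; rewrite pb' (negPf (side_neg vb')).
Qed.

Definition num_mixed_backward w : nat := #|[set i : 'I_n | mixed_backward w i]|.

Definition num_reachable b w : nat := #|[set y | connect (side_step b) w y]|.

Lemma connectE (r : rel 'S_n) x y : reflect (clos_refl_trans _ r x y) (connect r x y).
Proof.
apply: (iffP idP) => [/connectP[p]|].
  elim: p x => [|z p IH] x /= => [_ ->|/andP[xz zp] e]; first exact: rt_refl.
  by apply: rt_trans (IH _ zp e); apply: rt_step.
elim=> {x y} [x y xy|x|x y z _ xy _ yz]; [exact: connect1|exact: connect0|].
exact: connect_trans yz.
Qed.

Lemma num_mixed_backward_le b i k u w w' : u \in leaning ->
  (b = pol w i \/ u \in side c b) -> move i k u (T b u) w w' ->
  (num_mixed_backward w' <= num_mixed_backward w)%N.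
Proof.
move=> u_lean hb mw; apply/subset_leq_card/subsetP=> a; rewrite !inE.
exact: mixed_backward_move mw.
Qed.

Lemma num_mixed_backward_lt i k u w w' (b := pol w i) : u \in side c (~~ b) ->
  T b u \in side c b -> move i k u (T b u) w w' ->
  (num_mixed_backward w' < num_mixed_backward w)%N.
Proof.
move=> ub Tub mw; have /and3P[hw hw' _] := mw.
apply/proper_card/properP; split.
  by apply/subsetP=> a; rewrite !inE; apply: mixed_backward_move mw; [apply: leaning_side ub|left].
have [lt_i _] := hit_le_n hw; exists (Ordinal lt_i); rewrite inE /=.
  by apply/mixed_backwardP; exists k, u.
apply/mixed_backwardP=> -[k' [v [hv]]]; have [_ <-] := hit_inj hw' hv.
by rewrite (pol_move mw) (negPf (side_neg Tub)).
Qed.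

(** The word [w] itself is lost: if [w'] led back to it, acyclicity would give [w = w'], but a step
    changes the form of its hit. *)
Lemma num_reachable_lt b w w' : side_step b w w' ->
  (num_reachable b w' < num_reachable b w)%N.
Proof.
move=> ww'; apply/proper_card/properP; split.
  by apply/subsetP=> y; rewrite !inE; apply: connect_trans; apply: connect1.
exists w; rewrite inE ?connect0 //; apply/negP=> /connectE w'w.
have e : w = w' by apply: (proj1 (side_confluent b)) => //; apply: rt_step.
move: ww'; rewrite -e => /stepP[i [k [u [_ /eqP Tu /and3P[h1 h2 _]]]]].
by have [_] := hit_inj h2 h1.
Qed.

(* A move whose hit leans to the other side rearranges fixed positions and
   commutes with every step of [side_step b]; undoing it therefore embeds the
   words reachable after the move into those reachable before it. *)
Lemma num_reachable_le b i k u v w w' : u \in side c (~~ b) -> v \in side c (~~ b) ->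
  move i k u v w w' -> (num_reachable b w' <= num_reachable b w)%N.
Proof.
(* Since [(g * y) p] is [y (g p)], multiplying by [g] on the left permutes positions; it turns a
   reading of [v] at [i] into one of [u]. *)
move=> ub vb mw; pose g := (w * w'^-1)%g.
have [_ _ ag] := and3P mw; have /and3P[/hitP[le_n hw] /hitP[_ hw'] _] := mw.
have gE p : w' (g p) = w p by rewrite /g permM permKV.
have mg y : hit y i k v -> move i k v u y (g * y)%g.
  move=> hy; apply/and3P; split=> //.
    apply/hitP; split=> // j p e; rewrite permM.
    have [q eq wq] := hit_at (v^-1%g (u j)) (introT hitP (conj le_n hw')).
    have -> : g p = q.
      apply: (@perm_inj _ w'); apply: val_inj.
      by rewrite gE /= (hw _ _ e) wq permKV.
    by have [_ /(_ _ _ eq) ->] := hitP hy; rewrite permKV.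
  apply/agreeP=> p hp; rewrite permM; congr (y _).
  by apply: (@perm_inj _ w'); rewrite gE (agreeP ag).
have inv y : clos_refl_trans _ (side_step b) w' y ->
    hit y i k v /\ clos_refl_trans _ (side_step b) w (g * y)%g.
  move=> /(@clos_rt_rtn1 _ _ _ _); elim=> {y} [|y z /stepP[i' [k' [s [sb Ts mz]]]] _ [hy wy]].
    by split; [case/and3P: mw | rewrite /g mulgKV; apply: rt_refl].
  have /and3P[hs _ az] := mz; have ap := sides_apart hy hs vb sb.
  have hz := agree_hit ap az hy; split=> //; apply: rt_trans wy _; apply: rt_step.
  apply/stepP; exists i', k', s; split=> //.
  exact: move_square ap (mg _ hy) mz (mg _ hz).
rewrite /num_reachable -(card_imset _ (mulgI g)); apply/subset_leq_card/subsetP=> x.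
by case/imsetP=> y; rewrite !inE => /connectE/inv[_ /connectE] wy ->.
Qed.

(** A lexicographic order in one number: each count of reachable words is at most [#|{: 'S_n}|], so
    their sum stays below the weight of the first component. *)
Definition measure w : nat :=
  (num_mixed_backward w * (2 * #|{: 'S_n}|).+1 +
   (num_reachable true w + num_reachable false w))%N.

Lemma measure_side_step b w w' : side_step b w w' -> (measure w' < measure w)%N.
Proof.
move=> ww'; have lt_b := num_reachable_lt ww'.
case/stepP: ww' => i [k [u [ub _ mw]]].
have le_B := num_mixed_backward_le (leaning_side ub) (or_intror ub) mw.
have le_b : (num_reachable (~~ b) w' <= num_reachable (~~ b) w)%N.
  by apply: (num_reachable_le _ _ mw); rewrite negbK ?T_side.
rewrite /measure -addnS leq_add ?leq_mul2r ?le_B ?orbT //.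
by case: b lt_b le_b {ub mw} => lt_b le_b; [rewrite -addSn | rewrite -addnS]; apply: leq_add.
Qed.

Lemma measure_flip w w' : (num_mixed_backward w' < num_mixed_backward w)%N ->
  (measure w' < measure w)%N.
Proof.
move=> lt_B; apply: leq_trans (leq_addr _ _).
apply: (@leq_trans ((num_mixed_backward w').+1 * (2 * #|{: 'S_n}|).+1)%N).
  by rewrite /measure [leqRHS]mulSn -addnS [leqRHS]addnC leq_add2l ltnS mul2n -addnn leq_add // max_card.
by rewrite leq_mul2r lt_B orbT.
Qed.

(** A forward hit gives a side step for its polarization. For a backward one, [T_flip] gives either
    a side step for its own leaning or a flip. *)
Lemma step_cases w w' : step T leaning w w' ->
  (exists b, side_step b w w') \/ (num_mixed_backward w' < num_mixed_backward w)%N.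
Proof.
case/stepP=> i [k [u [u_lean Tu mw]]].
have [ub|nub] := boolP (u \in side c (pol w i)).
  by left; exists (pol w i); apply/stepP; exists i, k, u.
have ub := leaningN u_lean nub.
have := T_flip ub; rewrite negbK => -[e|Tub].
  by left; exists (~~ pol w i); apply/stepP; exists i, k, u; rewrite -e.
by right; apply: num_mixed_backward_lt mw.
Qed.

Lemma measure_step w w' : step T leaning w w' -> (measure w' < measure w)%N.
Proof. by case/step_cases=> [[b /measure_side_step]|/measure_flip]. Qed.

(** A side step is an actual step unless its hit is backward and has another target there. In that
    case [T_flip] and [T_comp] let the hit be flipped in both [x] and [y], with the same result
    [z]. *)
Lemma side_step_below b x y M : side_step b x y -> (measure x < M)%N ->
  connected_below (step T leaning) measure M x y.
Proof.
move=> xy xM; have yM := ltn_trans (measure_side_step xy) xM.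
case/stepP: xy => i [k [u [ub Tu mx]]]; have u_lean := leaning_side ub.
have [e|ne] := eqVneq (T (pol x i) u) (T b u).
  by apply: rst_step; split=> //; apply/stepP; exists i, k, u; rewrite e.
have pb : pol x i = ~~ b by move: ne; case: (pol x i); case: b {ub Tu mx} => //; rewrite eqxx.
have [e|Tnb] := T_flip ub; first by rewrite pb e eqxx in ne.
have /and3P[hx hy _] := mx.
have [z mz] := move_exists (T (~~ b) u) hx.
apply: (rst_trans _ _ _ z); [|apply: rst_sym]; apply: rst_step; split=> //; apply/stepP.
  exists i, k, u; rewrite pb; split=> //; apply: contraTneq Tnb => ->.
  exact: side_neg.
exists i, k, (T b u); rewrite (pol_move mx) T_comp //; split=> //.
  exact: leaning_side (T_side ub).
by rewrite pb; apply: move_trans mx mz.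
Qed.

Lemma side_steps_below b x y M : clos_refl_trans _ (side_step b) x y ->
  (measure x < M)%N -> connected_below (step T leaning) measure M x y.
Proof.
move=> /(@clos_rt_rt1n _ _ _ _); elim=> {x y} [x _|x y z xy _ IH xM]; first exact: rst_refl.
apply: (rst_trans _ _ _ y); first exact: side_step_below xy _.
by apply: IH; apply: ltn_trans xM; apply: measure_side_step xy.
Qed.

Lemma peak_below w x y : step T leaning w x -> step T leaning w y ->
  connected_below (step T leaning) measure (measure w) x y.
Proof.
move=> wx wy; have lt_x := measure_step wx; have lt_y := measure_step wy.
case/stepP: wx => i [k [u [u_lean Tu mx]]]; case/stepP: wy => i' [k' [v [v_lean Tv my]]].
have /and3P[hu hu' ax] := mx; have /and3P[hv hv' ay] := my.
have [ei|ni] := eqVneq i i'.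
  rewrite -{i'}ei in Tv my hv hv' ay; have [ek eu] := hit_inj hu hv.
  rewrite -ek -eu in my; rewrite (move_inj mx my); exact: rst_refl.
have [ap|nap] := boolP (apart i i').
  have ap' : apart i' i by rewrite apartC.
  have hxv := agree_hit ap' ax hv; have hyu := agree_hit ap ay hu.
  (* Neither move changes the polarization of the other hit, so both targets persist and the square
     closes. *)
  have [z mz] := move_exists (T (pol w i') v) hxv.
  have mz' := move_square ap' my mx mz.
  apply: (rst_trans _ _ _ z); [|apply: rst_sym]; apply: rst_step; split=> //; apply/stepP.
    by exists i', k', v; rewrite (pol_apart ap' hv mx).
  by exists i, k, u; rewrite (pol_apart ap hu my).
(* Overlapping hits are forward on a common side [b], so both steps are steps of [side_step b],
   whose confluence joins them at [m]. *)
have [b [ub vb pi pi']] := not_apart hu hv ni nap.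
rewrite pi in Tu mx; rewrite pi' in Tv my.
have wx : side_step b w x by apply/stepP; exists i, k, u.
have wy : side_step b w y by apply/stepP; exists i', k', v.
have [m [[_ to_m] _]] := proj2 (side_confluent b) w.
apply: (rst_trans _ _ _ m); [|apply: rst_sym]; apply: side_steps_below => //.
  by apply: to_m; apply: rst_step.
by apply: to_m; apply: rst_step.
Qed.

Lemma step_confluent : confluent (step T leaning).
Proof. exact: confluent_below measure_step peak_below. Qed.

End Operator.

(** * Application to a disjoint union *)

Lemma eq_step T T' (S : {set 'S_c}) w w' : (forall b u, u \in S -> T b u = T' b u) ->
  step T S w w' = step T' S w w'.
Proof.
move=> eqT; apply: eq_existsb => i; apply: eq_existsb => k; apply: eq_existsb => u.
by case: (boolP (u \in S)) => //= uS; rewrite eqT.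
Qed.

Section Union.
Variables (part : bool -> {set {set 'S_c}}) (rep : bool -> {set 'S_c}) (U : {set {set 'S_c}}).
Hypothesis part_side : forall b, partition (part b) (side c b).
Hypothesis rep_straightening : forall b, straightening_set (part b) (rep b).
Hypothesis partU : partition U leaning.
Hypothesis blockU : forall X b, X \in U -> X :&: side c b = set0 \/ X :&: side c b \in part b.
Let D := rep true :|: rep false.

Lemma rep_card b X b' : X \in part b -> X :&: side c b' != set0 ->
  #|rep b :&: X :&: side c b'| = 1%N.
Proof. by case: (rep_straightening b) => _ h /h[hL hR _ _]; case: b'. Qed.

Lemma rep_sub b u : u \in rep b -> u \in side c b.
Proof.
by case: (rep_straightening b) => /subsetP h _ /h; rewrite (cover_partition (part_side b)).
Qed.

Lemma in_rep_side b u : u \in side c b -> (u \in D) = (u \in rep b).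
Proof.
move=> ub; rewrite inE; case: b ub => ub.
  case: (boolP (u \in rep false)) => [/rep_sub|]; last by rewrite orbF.
  by rewrite (negPf (side_neg ub)).
case: (boolP (u \in rep true)) => [/rep_sub|] //=.
by rewrite (negPf (side_neg ub)).
Qed.

(** The trace of [X] on side [b] is a part of [part b], and [D] agrees with [rep b] on that side. *)
Lemma union_card X b : X \in U -> X :&: side c b != set0 -> #|D :&: X :&: side c b| = 1%N.
Proof.
move=> XU Xb; have [X0|Xp] := blockU b XU; first by rewrite X0 eqxx in Xb.
have Xbb : X :&: side c b :&: side c b = X :&: side c b by rewrite -setIA setIid.
have := rep_card (b' := b) Xp; rewrite Xbb => /(_ Xb) <-.
apply: eq_card => u; rewrite !inE -!andbA.
case: (boolP (u \in side c b)) => ub; last by rewrite !andbF.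
by rewrite -(in_rep_side ub) inE.
Qed.

Lemma pblock_side b u : u \in side c b -> pblock (part b) u = pblock U u :&: side c b.
Proof.
move=> ub; have u_lean := leaning_side ub.
have uX : u \in pblock U u :&: side c b by rewrite inE (in_block partU u_lean).
have [X0|Xp] := blockU b (block_in partU u_lean); first by rewrite X0 inE in uX.
by apply: def_pblock uX => //; case/and3P: (part_side b).
Qed.

Lemma side_leaning b : side c b \subset leaning.
Proof. by apply/subsetP=> u; apply: leaning_side. Qed.

(** A part of [part b] lies on side [b], so the exclusive or selects that side for either
    polarization [b']. This identifies straightening for [part b] with [side_step b]. *)
Lemma target_union b b' u : u \in side c b ->
  target (part b) (rep b) b' u = target U D b u.
Proof.
move=> ub; have u_lean := leaning_side ub.
have [tD tX tb] := target_in partU (subxx _) union_card b u_lean.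
have Xb : (pblock U u :&: side c b == set0) = false.
  by apply/set0Pn; exists u; rewrite inE (in_block partU u_lean).
rewrite Xb addbF in tb.
have tX' : target U D b u \in pblock (part b) u by rewrite pblock_side // inE tX.
apply: (target_eq (part_side b) (@side_leaning b) (@rep_card b)) => //.
  by rewrite -(in_rep_side tb).
have [->|ne] := eqVneq b' b.
  rewrite (_ : _ == _ = false) ?addbF //.
  by apply/set0Pn; exists u; rewrite inE pblock_side // inE (in_block partU u_lean) ub.
have -> : pblock (part b) u :&: side c b' = set0.
  apply/setP=> v; rewrite pblock_side // !inE; apply/negbTE/negP=> /andP[/andP[_ vb] vb'].
  by rewrite (side_inj vb vb') eqxx in ne.
by rewrite eqxx (_ : b' (+) true = b) //; case: b b' ne {ub tD tX tb Xb tX'} => [] [].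
Qed.

Lemma union_confluent : (forall b, C_confluent n (part b) (rep b)) -> C_confluent n U D.
Proof.
move=> confb; apply: (@confluent_eq _ (step (target U D) leaning)).
  by move=> w w'; rewrite (straighteningE partU (subxx _) union_card).
have tin := target_in partU (subxx _) union_card.
have T_side b u : u \in side c b -> target U D b u \in side c b.
  move=> ub; have [_ _] := tin b u (leaning_side ub).
  rewrite (_ : _ == _ = false) ?addbF //.
  by apply/set0Pn; exists u; rewrite inE ub (in_block partU (leaning_side ub)).
apply: step_confluent => // [b u ub|b b' u u_lean|b].
- have [tD tX] := tin (~~ b) u (leaning_side ub).
  case: eqP => _; rewrite ?addbF ?addbT ?negbK => tb; [left|by right].
  by rewrite (target_id partU (subxx _) union_card (leaning_side ub) tX tD tb).
- by have [_ tX _] := tin b u u_lean; apply: (target_block D partU).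
apply: confluent_eq (confb b) => w w'.
rewrite (straighteningE (part_side b) (@side_leaning b) (@rep_card b)) /side_step.
by rewrite (eq_step _ _ (T' := fun=> target U D b)) // => b' u; apply: target_union.
Qed.

End Union.

End Hits.

Theorem theorem2p6 (n c : nat) (c_gt0 : (0 < c)%N) (le_cn : (c <= n)%N)
    (P Q U : {set {set 'S_c}}) (C C' : {set 'S_c})
    (partP : partition P (Rset c)) (strP : straightening_set P C)
    (confP : C_confluent n P C)
    (partQ : partition Q (Lset c)) (strQ : straightening_set Q C')
    (confQ : C_confluent n Q C')
    (unionU : disjoint_union (Rset c) (Lset c) P Q U) :
  C_confluent n U (C :|: C').
Proof.
case: unionU => disj _ _ partU blockU.
pose part b := if b then P else Q; pose rep b := if b then C else C'.
have part_side b : partition (part b) (side c b) by case: b.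
apply: (@union_confluent n c c_gt0 disj part rep U) => //; try by case.
move=> X b XU; have [Y [Z [hY hZ _ ->]]] := blockU X XU.
have sub b' Y' : Y' = set0 \/ Y' \in part b' -> Y' \subset side c b'.
  case=> [->|]; first exact: sub0set.
  by move=> /bigcup_sup h; rewrite -(cover_partition (part_side b')); apply: h.
have YR := sub true Y hY; have ZL := sub false Z hZ.
have disj' (Y' : {set 'S_c}) b' : Y' \subset side c b' -> Y' :&: side c (~~ b') = set0.
  move=> /subsetP h; apply/setP=> u; rewrite !inE; apply/negbTE/negP=> /andP[/h ub].
  by rewrite (negPf (side_neg disj ub)).
(* Intersecting with a side keeps the summand of that side and empties the other. *)
rewrite setIUl; case: b.
  by rewrite (disj' Z false ZL) setU0 (setIidPl YR).
by rewrite (disj' Y true YR) set0U (setIidPl ZL).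
Qed.
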